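(* Let $\mathcal X=\{x\in\mathbb R^d:\|x\|_2\le1\}$, $T\ge2$, $L>0$, $\beta>0$, $C\ge0$, and let $f_1,\dots,f_T:\mathcal X\to\mathbb R$ be convex functions each of which is $L$-Lipschitz, $\beta$-smooth and $C$-self-concordant. Let $\psi(x)=-\log(1-\|x\|_2^2)$ and $$\eta=\min\left\{(\log T)^{2/5}(CL^3)^{-2/5}T^{-2/5},\ (\log T)^{1/3}(L^3+\beta L^2)^{-1/3}T^{-1/3}\right\}.$$ Then playing $x_t=\operatorname{argmin}_{x\in\mathcal X}\left\{\sum_{\tau=1}^{t-1}f_\tau(x)+\frac1\eta\psi(x)\right\}$ for $t=1,\dots,T+1$ guarantees $$\mathrm{Reg}_{\mathrm{Alt}}\le\mathcal O\!\left(\max\left\{(\log T)^{3/5}(CL^3)^{2/5}T^{2/5},\ (\log T)^{2/3}(L^3+\beta L^2)^{1/3}T^{1/3}\right\}\right),$$ where $\mathcal O(\cdot)$ hides an absolute constant (independent of $d$).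
   Context: Alternating regret: $\mathrm{Reg}_{\mathrm{Alt}}=\sup_{u\in\mathcal X}\left\{\sum_{t=1}^T\big(f_t(x_t)+f_t(x_{t+1})\big)-2\sum_{t=1}^T f_t(u)\right\}$. If $C=0$ the first term in the definition of $\eta$ is read as $+\infty$. $\psi$ is read as $+\infty$ on the unit sphere. All norms are Euclidean. A differentiable $f:\mathcal X\to\mathbb R$ is $L$-Lipschitz if $\|\nabla f(x)\|_2\le L$ for all $x\in\mathcal X$; $\beta$-smooth if $f(x)-f(y)-\langle\nabla f(y),x-y\rangle\le\frac\beta2\|x-y\|_2^2$ for all $x,y\in\mathcal X$; $C$-self-concordant if it is three times differentiable and $|\nabla^3f(x)[h,h,h]|\le2C(\nabla^2f(x)[h,h])^{3/2}$ for all $x\in\mathcal X$, $h\in\mathbb R^d$. *)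

(* Defs.v *)
From HB Require Import structures.
From mathcomp Require Export all_boot all_order all_algebra.
From mathcomp Require Export all_classical all_reals all_analysis.

Set Implicit Arguments.
Unset Strict Implicit.
Unset Printing Implicit Defensive.

Import Order.TTheory GRing.Theory Num.Theory.
Import numFieldNormedType.Exports.

Local Open Scope classical_set_scope.
Local Open Scope ring_scope.

(* The library norm on ['rV[R]_d] is the sup norm, so the Euclidean structure is
   defined here; the topology of ['rV[R]_d] is the Euclidean one. *)
Definition dotv (R : realType) (d : nat) (u v : 'rV[R]_d) : R :=
  \sum_(i < d) u 0 i * v 0 i.

Definition norm2 (R : realType) (d : nat) (u : 'rV[R]_d) : R :=
  Num.sqrt (dotv u u).

Definition unit_ball (R : realType) (d : nat) : set 'rV[R]_d :=
  [set x | norm2 x <= 1].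

(* A function on a subset [X] of R^d is represented by a total function whose
   values outside [X] are irrelevant.  Differentiability on [X] is relative to
   [X], so that at a boundary point only increments staying inside [X] matter
   and no extension of [f] beyond [X] is assumed.  On [unit_ball R d] the
   gradient, when it exists, is unique.  At [y = x] the quotient is 0 / 0 = 0. *)
Definition has_gradient (R : realType) (d : nat) (X : set 'rV[R]_d)
    (f : 'rV[R]_d -> R) (g : 'rV[R]_d -> 'rV[R]_d) : Prop :=
  forall x, X x ->
    (f y - f x - dotv (g x) (y - x)) / norm2 (y - x)
      @[y --> within X (nbhs x)] --> (0 : R).

Definition lipschitz_grad (R : realType) (d : nat) (X : set 'rV[R]_d) (L : R)
    (f : 'rV[R]_d -> R) : Prop :=
  exists2 g, has_gradient X f g & forall x, X x -> norm2 (g x) <= L.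

Definition smooth (R : realType) (d : nat) (X : set 'rV[R]_d) (beta : R)
    (f : 'rV[R]_d -> R) : Prop :=
  exists2 g, has_gradient X f g &
    forall x y, X x -> X y ->
      f x - f y - dotv (g y) (x - y) <= beta / 2 * norm2 (x - y) ^+ 2.

Definition quad_form (R : realType) (d : nat) (H : 'M[R]_d) (h : 'rV[R]_d) : R :=
  \sum_(i < d) \sum_(j < d) H i j * h 0 i * h 0 j.

Definition cubic_form (R : realType) (d : nat) (D : 'I_d -> 'M[R]_d)
    (h : 'rV[R]_d) : R :=
  \sum_(i < d) \sum_(j < d) \sum_(k < d) D i j k * h 0 i * h 0 j * h 0 k.

(* [H x i j] and [D x i j k] are the second and third partial derivatives of [f]
   at [x].  In finite dimension, differentiability of a vector- or matrix-valued
   map is differentiability of its entries, so the three [has_gradient] clauses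
   say that [f] is three times Frechet differentiable on [X]. *)
Definition self_concordant (R : realType) (d : nat) (X : set 'rV[R]_d) (C : R)
    (f : 'rV[R]_d -> R) : Prop :=
  exists (g : 'rV[R]_d -> 'rV[R]_d) (H : 'rV[R]_d -> 'M[R]_d)
         (D : 'rV[R]_d -> 'I_d -> 'M[R]_d),
  [/\ has_gradient X f g,
      forall i, has_gradient X (fun x => g x 0 i) (fun x => row i (H x)),
      forall i j, has_gradient X (fun x => H x i j) (fun x => row j (D x i)) &
      forall x h, X x ->
        `|cubic_form (D x) h| <= 2 * C * (quad_form (H x) h `^ (3 / 2))].

Definition log_barrier (R : realType) (d : nat) (x : 'rV[R]_d) : \bar R :=
  if norm2 x < 1 then (- ln (1 - norm2 x ^+ 2))%:E else +oo%E.

Definition argmin (R : realType) (V : Type) (X : set V) (F : V -> \bar R) : set V :=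
  [set x | X x /\ forall y, X y -> (F x <= F y)%E].

Definition ftrl_objective (R : realType) (d : nat) (f : nat -> 'rV[R]_d -> R)
    (eta : R) (t : nat) (y : 'rV[R]_d) : \bar R :=
  ((\sum_(1 <= s < t) f s y)%:E + (eta^-1)%:E * log_barrier y)%E.

(* Since [0 `^ r = 0] for every [r != 0], the case [C = 0], where the first term
   of the minimum is infinite, has to be separated. *)
Definition step_size (R : realType) (T : nat) (L beta C : R) : R :=
  let logT := ln (T%:R : R) in
  let eta1 := logT `^ (2 / 5) * (C * L ^+ 3) `^ (- (2 / 5))
              * T%:R `^ (- (2 / 5)) in
  let eta2 := logT `^ (1 / 3) * (L ^+ 3 + beta * L ^+ 2) `^ (- (1 / 3))
              * T%:R `^ (- (1 / 3)) in
  if C == 0 then eta2 else Num.min eta1 eta2.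

Definition regret_rate (R : realType) (T : nat) (L beta C : R) : R :=
  let logT := ln (T%:R : R) in
  Num.max (logT `^ (3 / 5) * (C * L ^+ 3) `^ (2 / 5) * T%:R `^ (2 / 5))
          (logT `^ (2 / 3) * (L ^+ 3 + beta * L ^+ 2) `^ (1 / 3)
           * T%:R `^ (1 / 3)).

Definition alt_regret (R : realType) (d : nat) (X : set 'rV[R]_d) (T : nat)
    (f : nat -> 'rV[R]_d -> R) (x : nat -> 'rV[R]_d) : \bar R :=
  ereal_sup [set (\sum_(1 <= t < T.+1) (f t (x t) + f t (x t.+1))
                  - 2 * \sum_(1 <= t < T.+1) f t u)%:E | u in X].

(* Main.v *)
Require Import Defs.
From mathcomp Require Import ring lra.
Import Order.TTheory GRing.Theory Num.Theory.
Import numFieldNormedType.Exports.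
Set Implicit Arguments.
Unset Strict Implicit.
Unset Printing Implicit Defensive.
Local Open Scope classical_set_scope.
Local Open Scope ring_scope.

(* Put F_t = sum_(s < t) f_s + psi / eta.  Telescoping F_(t+1)(x_(t+1)) - F_t(x_t)
   turns the alternating regret against an interior point u into
   2 psi(u) / eta plus the sum over t of
     D_t = 2 (F_t(x_t) - F_t(x_(t+1))) + f_t(x_t) - f_t(x_(t+1)).
   On the segment from x_(t+1) to x_t, first-order optimality fixes the two end
   slopes of F_t, and the trapezoid rule gives F_t(x_t) - F_t(x_(t+1)) up to the
   third derivative, so that D_t is at most f_t(x_t) - f_t(x_(t+1)) minus its
   linearisation at x_(t+1) (controlled by smoothness) plus a third-order error.
   F_t is (C + sqrt eta)-self-concordant and 2/eta-strongly convex, whence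
   |x_t - x_(t+1)| <= eta L / 2 and the error is O((C + sqrt eta) (L sqrt eta)^3).
   A comparator on the sphere is first shrunk by the factor 1 - 1/T. *)

(** * One-variable calculus: mean values, the trapezoid rule, self-concordance *)

Lemma MVT_closed (R : realType) (f df : R -> R) (a b : R) :
    a <= b -> (forall x : R, a <= x <= b -> is_derive x 1 f (df x)) ->
  exists2 c, a <= c <= b & f b - f a = df c * (b - a).
Proof.
move=> ab dfE; have [||c] := @MVT_segment R f df a b ab.
- by move=> x; rewrite in_itv/= => /andP[/ltW ax /ltW xb]; apply: dfE; rewrite ax.
- apply: derivable_within_continuous => x; rewrite in_itv/= => xab.
  by have [] := dfE x xab.
by rewrite in_itv/= => cab E; exists c.
Qed.

(** Three mean values: for [e], with [e' = (p1 s - p1 0 - s * p2 s) / 2], then for [p1] on [[0, c]],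
    then for [p2] on [[k, c]]. The error becomes [- c * (c - k) * p3 j / 2] with
    [0 <= c * (c - k) <= 1]. A sharp constant is not sought. *)
Lemma trapezoid_error (R : realType) (p0 p1 p2 p3 : R -> R) (B : R) :
    (forall s : R, 0 <= s <= 1 -> is_derive s 1 p0 (p1 s)) ->
    (forall s : R, 0 <= s <= 1 -> is_derive s 1 p1 (p2 s)) ->
    (forall s : R, 0 <= s <= 1 -> is_derive s 1 p2 (p3 s)) ->
    (forall s, 0 <= s <= 1 -> `|p3 s| <= B) ->
  p0 1 - p0 0 - (p1 0 + p1 1) / 2 <= B / 2.
Proof.
move=> d0 d1 d2 p3B.
pose e := p0 - (fun s : R => s) * (cst (p1 0) + p1) * cst 2^-1.
have de (s : R) : 0 <= s <= 1 -> is_derive s 1 e ((p1 s - p1 0 - s * p2 s) / 2).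
  move=> s01; have ? := d0 s s01; have ? := d1 s s01.
  by apply: is_derive_eq; rewrite /= /GRing.scale/= !fctE/=; field.
have [c /andP[c0 c1]] := MVT_closed ler01 de.
rewrite subr0 mulr1 /e !fctE => E.
have [| |k /andP[k0 kc] E1] := @MVT_closed R p1 p2 0 c; rewrite ?c0//.
  by move=> s /andP[s0 sc]; apply: d1; rewrite s0 (le_trans sc).
have [| |j /andP[kj jc] E2] := @MVT_closed R p2 p3 k c; rewrite ?kc//.
  by move=> s /andP[s0 sc]; apply: d2; rewrite (le_trans k0 s0) (le_trans sc).
have {E}-> : p0 1 - p0 0 - (p1 0 + p1 1) / 2 = - (c * (c - k) * p3 j / 2).
  have -> : - (c * (c - k) * p3 j / 2) = (p1 c - p1 0 - c * p2 c) / 2.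
    have -> : p1 c - p1 0 = p2 k * c by rewrite E1 subr0.
    by have -> : p2 c = p3 j * (c - k) + p2 k by [rewrite -E2 subrK]; field.
  by rewrite -E; field.
have j01 : 0 <= j <= 1 by rewrite (le_trans k0 kj) (le_trans jc).
have := p3B j j01; rewrite ler_norml => /andP[lB uB].
have B0 : 0 <= B by rewrite (le_trans _ (p3B j j01)).
have ck1 : c * (c - k) <= 1 by nra.
have ck0 : 0 <= c * (c - k) by rewrite mulr_ge0// subr_ge0.
nra.
Qed.

Lemma variation_bound (R : realType) (f df : R -> R) (M a b : R) :
    (forall s : R, 0 <= s <= 1 -> is_derive s 1 f (df s)) ->
    (forall s, 0 <= s <= 1 -> `|df s| <= M) ->
  0 <= a <= 1 -> 0 <= b <= 1 -> f b - f a <= M.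
Proof.
move=> dfE dfM a01 b01; apply: le_trans (ler_norm _) _.
wlog ab : a b a01 b01 / a <= b => [hw|].
  have [/hw|/ltW /hw] := leP a b; first exact.
  by rewrite distrC; apply.
have [|c cab ->] := @MVT_closed _ f df a b ab.
  by move=> s sab; apply: dfE; lra.
have c01 : 0 <= c <= 1 by lra.
rewrite normrM -[leRHS]mulr1 ler_pM ?dfM//.
by rewrite ger0_norm; lra.
Qed.

(* Self-concordance says exactly that [u ^ (-1/2)] is [M]-Lipschitz. *)
Lemma concordant_bound (R : realType) (u v : R -> R) (M c s : R) :
    (forall s : R, 0 <= s <= 1 -> is_derive s 1 u (v s)) ->
    (forall s, 0 <= s <= 1 -> 0 < u s) ->
    (forall s, 0 <= s <= 1 -> `|v s| <= 2 * M * (u s * Num.sqrt (u s))) ->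
    0 <= c <= 1 -> 0 <= s <= 1 -> M * Num.sqrt (u c) <= 1 / 2 ->
  Num.sqrt (u s) <= 2 * Num.sqrt (u c).
Proof.
move=> du u0 vM c01 s01 Mc.
pose r := fun s => (Num.sqrt (u s))^-1.
have su0 x : 0 <= x <= 1 -> 0 < Num.sqrt (u x) by move=> x01; rewrite sqrtr_gt0 u0.
have M0 : 0 <= M.
  have := le_trans (normr_ge0 _) (vM c c01).
  by rewrite pmulr_lge0 ?mulr_gt0 ?u0 ?su0// pmulr_rge0.
have dr (x : R) : 0 <= x <= 1 -> is_derive x 1 r (- v x / (2 * (u x * Num.sqrt (u x)))).
  move=> x01; have ? := du x x01; have ux := u0 x x01; have ? := is_derive1_sqrt ux.
  have dsu : is_derive x 1 (fun s => Num.sqrt (u s)) ((2 * Num.sqrt (u x))^-1 * v x).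
    apply: is_derive_eq; rewrite /GRing.scale/= mulrC//.
  have su := su0 x x01.
  have := @is_deriveV _ (fun s => Num.sqrt (u s)) x _ 1 (lt0r_neq0 su) dsu.
  move=> /is_derive_eq; apply; rewrite /GRing.scale/=.
  have := sqr_sqrtr (ltW ux); move: (Num.sqrt (u x)) su => q q0 <-.
  by field; rewrite lt0r_neq0.
have drM x : 0 <= x <= 1 -> `|- v x / (2 * (u x * Num.sqrt (u x)))| <= M.
  move=> x01; have ? := u0 x x01; have ? := su0 x x01.
  have w0 : 0 < 2 * (u x * Num.sqrt (u x)) by rewrite !mulr_gt0.
  rewrite normrM normrN normfV (gtr0_norm w0) ler_pdivrMr//; apply: le_trans (vM x x01) _.
  by rewrite [leRHS]mulrCA -mulrA.
have key : r c - r s <= M := variation_bound dr drM s01 c01.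
have sc := su0 c c01; have ss := su0 s s01; move: key; rewrite /r => key.
(* Cleared of denominators, [key] bounds [sqrt (u s) - sqrt (u c)] by [M * sqrt (u c) * sqrt (u s)],
   which is at most half of [sqrt (u s)]. *)
have := ler_wpM2r (ltW (mulr_gt0 sc ss)) key.
have -> : ((Num.sqrt (u c))^-1 - (Num.sqrt (u s))^-1) * (Num.sqrt (u c) * Num.sqrt (u s))
   = Num.sqrt (u s) - Num.sqrt (u c) by field; rewrite !lt0r_neq0.
nra.
Qed.

(** The weight [eta^-1] turns the constant 1 of the barrier into [sqrt eta], because
    [eta^-1 * q2 <= u] gives [sqrt q2 <= sqrt eta * sqrt u]. The two constants then add, since [p2]
    and [eta^-1 * q2] are both below the total [u]. *)
Lemma concordant_add (R : realType) (C eta p2 p3 q2 q3 : R) :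
    0 < eta -> 0 <= C -> 0 <= p2 -> 0 <= q2 ->
    `|p3| <= 2 * C * (p2 * Num.sqrt p2) -> `|q3| <= 2 * (q2 * Num.sqrt q2) ->
  `|p3 + eta^-1 * q3| <= 2 * (C + Num.sqrt eta) *
     ((p2 + eta^-1 * q2) * Num.sqrt (p2 + eta^-1 * q2)).
Proof.
move=> eta0 C0 p20 q20 hp hq; have eta_ge0 := ltW eta0; set u := p2 + _.
have q2u : eta^-1 * q2 <= u by rewrite lerDr.
have p2u : p2 <= u by rewrite lerDl mulr_ge0// invr_ge0.
have u0 : 0 <= u by rewrite (le_trans p20).
have sq : Num.sqrt q2 <= Num.sqrt eta * Num.sqrt u.
  by rewrite -sqrtrM// ler_sqrt ?mulr_ge0// -ler_pdivrMl.
have hp' : p2 * Num.sqrt p2 <= u * Num.sqrt u by rewrite ler_pM ?sqrtr_ge0 ?ler_sqrt.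
have hq' : eta^-1 * q2 * Num.sqrt q2 <= u * (Num.sqrt eta * Num.sqrt u).
  by rewrite ler_pM ?sqrtr_ge0// mulr_ge0// invr_ge0.
apply: le_trans (ler_normD _ _) _; rewrite normrM gtr0_norm ?invr_gt0//.
have -> : 2 * (C + Num.sqrt eta) * (u * Num.sqrt u) =
   2 * C * (u * Num.sqrt u) + 2 * (u * (Num.sqrt eta * Num.sqrt u)) by ring.
apply: lerD.
  by apply: le_trans hp _; rewrite ler_wpM2l// mulr_ge0.
apply: le_trans (_ : 2 * (eta^-1 * q2 * Num.sqrt q2) <= _); last by rewrite ler_wpM2l.
rewrite (_ : 2 * _ = eta^-1 * (2 * (q2 * Num.sqrt q2))); last by ring.
by rewrite ler_wpM2l// invr_ge0.
Qed.

(* [p] is the sum of the past losses, [q] the barrier and [f] the new loss, all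
   restricted to the segment from [x_(t+1)] (parameter 0) to [x_t] (parameter 1),
   whose length is [N].  If [(C + sqrt eta) * L * sqrt eta > 1/2], the Hessian is
   not stable along the segment, but then the Lipschitz bound is good enough. *)
Lemma segment_bound (R : realType) (p0 p1 p2 p3 q0 q1 q2 q3 : R -> R)
    (f0 f1 df eta L C beta N : R) :
    0 < eta -> 0 < L -> 0 <= C -> 0 < beta -> 0 < N ->
    (forall s : R, 0 <= s <= 1 -> is_derive s 1 p0 (p1 s)) ->
    (forall s : R, 0 <= s <= 1 -> is_derive s 1 p1 (p2 s)) ->
    (forall s : R, 0 <= s <= 1 -> is_derive s 1 p2 (p3 s)) ->
    (forall s : R, 0 <= s <= 1 -> is_derive s 1 q0 (q1 s)) ->
    (forall s : R, 0 <= s <= 1 -> is_derive s 1 q1 (q2 s)) ->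
    (forall s : R, 0 <= s <= 1 -> is_derive s 1 q2 (q3 s)) ->
    (forall s, 0 <= s <= 1 ->
      0 <= p2 s /\ `|p3 s| <= 2 * C * (p2 s * Num.sqrt (p2 s))) ->
    (forall s, 0 <= s <= 1 ->
      2 * N ^+ 2 <= q2 s /\ `|q3 s| <= 2 * (q2 s * Num.sqrt (q2 s))) ->
    p1 1 + eta^-1 * q1 1 = 0 -> p1 0 + eta^-1 * q1 0 = - df ->
    p0 1 + eta^-1 * q0 1 <= p0 0 + eta^-1 * q0 0 ->
    df <= L * N -> f1 - f0 <= L * N -> f1 - f0 - df <= beta / 2 * N ^+ 2 ->
  2 * ((p0 1 + eta^-1 * q0 1) - (p0 0 + eta^-1 * q0 0)) + (f1 - f0) <=
  16 * (C * L ^+ 3 * (eta * Num.sqrt eta) + (L ^+ 3 + beta * L ^+ 2) * eta ^+ 2).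
Proof.
move=> eta0 L0 C0 beta0 N0 dp0 dp1 dp2 dq0 dq1 dq2 hp hq opt1 opt0 mono dfL fL fb.
have [eta_ge0 L_ge0 beta_ge0] : [/\ 0 <= eta, 0 <= L & 0 <= beta] by rewrite !ltW.
pose phi (p q : R -> R) : R -> R := p + eta^-1 *: (q : R -> R^o).
have dphi (p q dp dq : R -> R) :
    (forall s : R, 0 <= s <= 1 -> is_derive s 1 p (dp s)) ->
    (forall s : R, 0 <= s <= 1 -> is_derive s 1 q (dq s)) ->
    (forall s : R, 0 <= s <= 1 -> is_derive s 1 (phi p q) (phi dp dq s)).
  move=> hdp hdq s s01.
  exact: (is_deriveD (hdp s s01) (is_deriveZ eta^-1 (hdq s s01))).
have d0 := dphi _ _ _ _ dp0 dq0; have d1 := dphi _ _ _ _ dp1 dq1.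
have d2 := dphi _ _ _ _ dp2 dq2.
set r := Num.sqrt eta; have r0 : 0 < r by rewrite sqrtr_gt0.
have r_ge0 := ltW r0; have N_ge0 := ltW N0; have r2 : eta = r ^+ 2 by rewrite sqr_sqrtr.
have ie0 : 0 <= eta^-1 by rewrite invr_ge0.
have phiE p q s : phi p q s = p s + eta^-1 * q s by [].
have u0 s : 0 <= s <= 1 -> eta^-1 * (2 * N ^+ 2) <= phi p2 q2 s.
  move=> s01; have [p20 _] := hp s s01; have [q20 _] := hq s s01.
  by rewrite phiE -[leLHS]add0r lerD// ler_wpM2l.
have upos s : 0 <= s <= 1 -> 0 < phi p2 q2 s.
  by move=> /u0; apply: lt_le_trans; rewrite !mulr_gt0 ?invr_gt0.
(* The end slopes of the objective are [- df] and [0], so its second derivative equals [df <= L * N]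
   at some [c]. Against the strong convexity bound [2 * N ^+ 2 / eta] this limits [N], and then the
   second derivative at [c] itself. *)
have [c c01] := MVT_closed ler01 d1.
rewrite subr0 mulr1 !phiE opt1 opt0 sub0r opprK -phiE => dfE.
have NL : N <= eta * L / 2.
  have := u0 c c01; rewrite -dfE => /le_trans/(_ dfL).
  rewrite ler_pdivrMl// => h; rewrite -(ler_pM2l N0).
  nra.
have ucL : phi p2 q2 c <= (L * r) ^+ 2.
  rewrite -dfE (le_trans dfL)//; apply: le_trans (ler_wpM2l L_ge0 NL) _.
  rewrite exprMn -r2; have : 0 <= L ^+ 2 * eta by rewrite mulr_ge0 ?exprn_ge0.
  by lra.
have sucL : Num.sqrt (phi p2 q2 c) <= L * r.
  have Lr0 : 0 <= L * r by rewrite mulr_ge0.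
  by rewrite -(ger0_norm Lr0) -sqrtr_sqr ler_sqrt// exprn_ge0.
have M0 : 0 <= C + r by rewrite addr_ge0.
have goal3 : 0 <= 16 * ((C + r) * (L * r) ^+ 3).
  by rewrite !mulr_ge0// exprn_ge0// mulr_ge0.
have bN : beta / 2 * N ^+ 2 <= beta * L ^+ 2 * eta ^+ 2.
  have N2 : N ^+ 2 <= (eta * L / 2) ^+ 2.
    by rewrite ler_pXn2r// nnegrE ltW// (lt_le_trans N0).
  apply: le_trans (ler_wpM2l _ N2) _; first by rewrite divr_ge0.
  have : 0 <= beta * L ^+ 2 * eta ^+ 2 by rewrite !mulr_ge0 ?exprn_ge0.
  have -> : beta / 2 * (eta * L / 2) ^+ 2 = (beta * L ^+ 2 * eta ^+ 2) / 8 by field.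
  by lra.
have rhsE : 16 * (C * L ^+ 3 * (eta * r) + (L ^+ 3 + beta * L ^+ 2) * eta ^+ 2) =
    16 * ((C + r) * (L * r) ^+ 3) + 16 * (beta * L ^+ 2 * eta ^+ 2).
  by rewrite r2; ring.
have b0 : 0 <= beta * L ^+ 2 * eta ^+ 2 by rewrite !mulr_ge0 ?exprn_ge0.
rewrite rhsE -!phiE.
have [small|big] := leP ((C + r) * (L * r)) (1 / 2); last first.
  (* By [mono] the first term is nonpositive. What remains is at most [L * N <= (L * r) ^+ 2 / 2],
     while the target exceeds [8 * (L * r) ^+ 2] in this case. *)
  have D : 2 * (phi p0 q0 1 - phi p0 q0 0) + (f1 - f0) <= L * N.
    by move: mono; rewrite -!phiE; lra.
  apply: le_trans D _.
  have : L * N <= (L * r) ^+ 2 / 2.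
    by apply: le_trans (ler_wpM2l L_ge0 NL) _; rewrite r2 exprMn; lra.
  have Lr2 : 0 < (L * r) ^+ 2 by rewrite exprn_gt0// mulr_gt0.
  have -> : (C + r) * (L * r) ^+ 3 = (C + r) * (L * r) * (L * r) ^+ 2 by ring.
  nra.
have sb s : 0 <= s <= 1 -> Num.sqrt (phi p2 q2 s) <= 2 * (L * r).
  move=> s01; apply: le_trans (_ : 2 * Num.sqrt (phi p2 q2 c) <= _); last first.
    by rewrite ler_wpM2l.
  apply: (concordant_bound (M := C + r) d2) => //.
    move=> x x01; have [p20 p3b] := hp x x01; have [q20 q3b] := hq x x01.
    apply: concordant_add => //.
    by apply: le_trans q20; rewrite mulr_ge0 ?exprn_ge0.
  by apply: le_trans small; rewrite ler_wpM2l.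
(* The constant is [16 = 2 * 2 ^+ 3]: the 2 of self-concordance and the cube of the factor 2 in
   [sb]. *)
have B s : 0 <= s <= 1 -> `|phi p3 q3 s| <= 16 * ((C + r) * (L * r) ^+ 3).
  move=> s01; have [p20 p3b] := hp s s01; have [q20 q3b] := hq s s01.
  apply: le_trans (concordant_add eta0 C0 p20 _ p3b q3b) _.
    by apply: le_trans q20; rewrite mulr_ge0 ?exprn_ge0.
  rewrite -!phiE -/r; have := sb s s01; have := upos s s01.
  move: (phi p2 q2 s) => u up su.
  have uE : u = Num.sqrt u ^+ 2 by rewrite sqr_sqrtr// ltW.
  rewrite {1}uE -exprSr; have : Num.sqrt u ^+ 3 <= (2 * (L * r)) ^+ 3.
    by rewrite ler_pXn2r// nnegrE ?sqrtr_ge0// !mulr_ge0.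
  move=> /(ler_wpM2l M0) h; have -> : 16 * ((C + r) * (L * r) ^+ 3) =
     2 * ((C + r) * (2 * (L * r)) ^+ 3) by ring.
  by rewrite -mulrA ler_wpM2l.
(* The mean of the end slopes is [- df / 2], so twice the trapezoid bound leaves exactly
   [f1 - f0 - df], to which smoothness applies. *)
have := trapezoid_error d0 d1 d2 B.
rewrite !(phiE p1) opt1 opt0 addr0 => trap.
lra.
Qed.

Lemma is_derive_bigsum (R : realType) (I : eqType) (r : seq I) (F : I -> R -> R)
    (dF : I -> R) (s : R) :
    (forall i, i \in r -> is_derive s 1 (F i) (dF i)) ->
  is_derive s 1 (fun x => \sum_(i <- r) F i x) (\sum_(i <- r) dF i).
Proof.
elim: r => [_|i r IHr dFE].
  under eq_fun do rewrite big_nil; rewrite big_nil; exact: is_derive_cst.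
under eq_fun do rewrite big_cons; rewrite big_cons.
apply: (@is_deriveD _ _ _ (F i)); first by apply: dFE; rewrite mem_head.
by apply: IHr => j jr; apply: dFE; rewrite in_cons jr orbT.
Qed.

(** * The Euclidean inner product and norm *)

Lemma dotvC (R : realType) (d : nat) (u v : 'rV[R]_d) : dotv u v = dotv v u.
Proof. by apply: eq_bigr => i _; rewrite mulrC. Qed.

Lemma dotvDl (R : realType) (d : nat) (u v w : 'rV[R]_d) :
  dotv (u + v) w = dotv u w + dotv v w.
Proof. by rewrite -big_split; apply: eq_bigr => i _; rewrite mxE mulrDl. Qed.

Lemma dotvZl (R : realType) (d : nat) (r : R) (u v : 'rV[R]_d) :
  dotv (r *: u) v = r * dotv u v.
Proof. by rewrite mulr_sumr; apply: eq_bigr => i _; rewrite mxE mulrA. Qed.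

Lemma dotvDr (R : realType) (d : nat) (u v w : 'rV[R]_d) :
  dotv w (u + v) = dotv w u + dotv w v.
Proof. by rewrite dotvC dotvDl !(dotvC w). Qed.

Lemma dotvZr (R : realType) (d : nat) (r : R) (u v : 'rV[R]_d) :
  dotv v (r *: u) = r * dotv v u.
Proof. by rewrite dotvC dotvZl dotvC. Qed.

Lemma dotvNl (R : realType) (d : nat) (u v : 'rV[R]_d) : dotv (- u) v = - dotv u v.
Proof. by rewrite -scaleN1r dotvZl mulN1r. Qed.

Lemma dotvNr (R : realType) (d : nat) (u v : 'rV[R]_d) : dotv v (- u) = - dotv v u.
Proof. by rewrite dotvC dotvNl dotvC. Qed.

Lemma dotv0r (R : realType) (d : nat) (u : 'rV[R]_d) : dotv u 0 = 0.
Proof. by rewrite -(scale0r u) dotvZr mul0r. Qed.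

Lemma dotvv_ge0 (R : realType) (d : nat) (u : 'rV[R]_d) : 0 <= dotv u u.
Proof. by apply: sumr_ge0 => i _; rewrite -expr2 sqr_ge0. Qed.

Lemma dotvv_eq0 (R : realType) (d : nat) (u : 'rV[R]_d) : dotv u u = 0 -> u = 0.
Proof.
move=> /psumr_eq0P u0; apply/rowP => i; rewrite mxE; apply/eqP.
by rewrite -sqrf_eq0 expr2 u0// => j _; rewrite -expr2 sqr_ge0.
Qed.

Lemma sqr_norm2 (R : realType) (d : nat) (u : 'rV[R]_d) : norm2 u ^+ 2 = dotv u u.
Proof. by rewrite sqr_sqrtr// dotvv_ge0. Qed.

Lemma norm2_ge0 (R : realType) (d : nat) (u : 'rV[R]_d) : 0 <= norm2 u.
Proof. exact: sqrtr_ge0. Qed.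

Lemma norm2_le1 (R : realType) (d : nat) (u : 'rV[R]_d) :
  (norm2 u <= 1) = (dotv u u <= 1).
Proof. by rewrite -sqr_norm2 expr_le1// norm2_ge0. Qed.

Lemma norm2_lt1 (R : realType) (d : nat) (u : 'rV[R]_d) :
  (norm2 u < 1) = (dotv u u < 1).
Proof. by rewrite -sqr_norm2 expr_lt1// norm2_ge0. Qed.

Lemma norm2Z (R : realType) (d : nat) (r : R) (u : 'rV[R]_d) :
  norm2 (r *: u) = `|r| * norm2 u.
Proof.
by rewrite /norm2 dotvZl dotvZr mulrA -expr2 sqrtrM ?sqr_ge0// sqrtr_sqr.
Qed.

Lemma norm2_gt0 (R : realType) (d : nat) (u : 'rV[R]_d) : u != 0 -> 0 < norm2 u.
Proof.
move=> u0; rewrite sqrtr_gt0 lt_neqAle dotvv_ge0 andbT eq_sym.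
by apply: contra u0 => /eqP /dotvv_eq0 ->.
Qed.

(** Cauchy-Schwarz, by expanding the squared length of [norm2 v ^+ 2 *: u - dotv u v *: v]. *)
Lemma dotv_le_norm2 (R : realType) (d : nat) (u v : 'rV[R]_d) :
  dotv u v <= norm2 u * norm2 v.
Proof.
have [->|v0] := eqVneq v 0.
  by rewrite dotv0r mulr_ge0 ?norm2_ge0.
have nv := norm2_gt0 v0; have nu := norm2_ge0 u.
have := dotvv_ge0 (norm2 v ^+ 2 *: u - dotv u v *: v).
rewrite !(dotvDl, dotvDr, dotvNl, dotvNr, dotvZl, dotvZr) (dotvC v u) -!sqr_norm2.
rewrite (_ : _ + _ = norm2 v ^+ 2 * ((norm2 u * norm2 v) ^+ 2 - dotv u v ^+ 2)); last by ring.
rewrite pmulr_rge0 ?exprn_gt0// subr_ge0 => h.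
apply: le_trans (ler_norm _) _.
by rewrite -ler_sqr ?nnegrE// ?mulr_ge0 ?norm2_ge0// real_normK ?num_real.
Qed.

Lemma dotv_line (R : realType) (d : nat) (b h : 'rV[R]_d) (s : R) :
  dotv (b + s *: h) (b + s *: h) = dotv b b + 2 * dotv b h * s + dotv h h * s ^+ 2.
Proof.
by rewrite !(dotvDl, dotvDr, dotvZl, dotvZr) (dotvC h b); ring.
Qed.

(** * Segments inside the ball and derivatives along them *)

(** One minus the squared norm of the point is [(1-s)(1-|b|^2) + s(1-|a|^2) + s(1-s)|a-b|^2], whose
    first term is positive. *)
Lemma line_lt1 (R : realType) (d : nat) (b a : 'rV[R]_d) (s : R) :
    dotv b b < 1 -> dotv a a <= 1 -> 0 <= s < 1 ->
  dotv (b + s *: (a - b)) (b + s *: (a - b)) < 1.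
Proof.
move=> b1 a1 /andP[s0 s1].
have -> : b + s *: (a - b) = (1 - s) *: b + s *: a.
  by rewrite scalerBr scalerBl scale1r addrA addrAC.
have := dotvv_ge0 (a - b).
rewrite !(dotvDl, dotvDr, dotvNl, dotvNr, dotvZl, dotvZr) (dotvC b a) => h.
have e1 : 0 < (1 - s) * (1 - dotv b b) by rewrite mulr_gt0// subr_gt0.
have e2 : 0 <= s * (1 - dotv a a) by rewrite mulr_ge0// subr_ge0.
have e3 : 0 <= s * (1 - s) * (dotv a a + - dotv a b + (- dotv a b - - dotv b b)).
  by rewrite !mulr_ge0// subr_ge0 ltW.
lra.
Qed.

Lemma open_unit_ball_line (R : realType) (d : nat) (b h : 'rV[R]_d) (s : R) :
    dotv (b + s *: h) (b + s *: h) < 1 ->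
  \forall r \near s, dotv (b + r *: h) (b + r *: h) < 1.
Proof.
move=> lt1.
pose w (r : R) := dotv b b + 2 * dotv b h * r + dotv h h * (r * r).
have wE r : dotv (b + r *: h) (b + r *: h) = w r by rewrite dotv_line /w expr2.
have cw : w r @[r --> s] --> w s.
  apply: cvgD; first (apply: cvgD; first exact: cvg_cst).
    by apply: cvgMr; exact: cvg_id.
  by apply: cvgMr; apply: cvgM; exact: cvg_id.
rewrite wE in lt1; near=> r; rewrite wE; near: r.
exact: (cvgr_lt _ cw).
Unshelve. all: by end_near. Qed.

(** The limit in [has_gradient] is relative to the ball. Around an interior point the line stays in
    the ball for small increments, so that limit can be taken along the line; the error quotient is
    rescaled by [norm2 h]. *)
Lemma is_derive_line (R : realType) (d : nat) (f : 'rV[R]_d -> R) g b h (s : R) :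
    has_gradient (@unit_ball R d) f g -> dotv (b + s *: h) (b + s *: h) < 1 ->
  is_derive s 1 (fun r : R => f (b + r *: h)) (dotv (g (b + s *: h)) h).
Proof.
move=> fg lt1; set x := b + s *: h.
have Bx : unit_ball x by rewrite /unit_ball/= norm2_le1 ltW.
have := fg x Bx; set e := fun y : 'rV[R]_d => _ / _ => e0.
pose path (r : R) := x + r *: h.
have c0 : path r @[r --> 0^'] --> x.
  apply: cvg_trans (_ : path r @[r --> 0] --> x).
    by apply: cvg_app; exact: nbhs_dnbhs.
  rewrite -[X in _ --> X]addr0 -(scale0r h).
  by apply: cvgD; [exact: cvg_cst|apply: cvgZl; exact: cvg_id].
have lt0 : dotv (x + 0 *: h) (x + 0 *: h) < 1 by rewrite scale0r addr0.
have nB : \forall r \near 0^', dotv (path r) (path r) < 1.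
  exact: nbhs_dnbhs (open_unit_ball_line lt0).
have cw : path r @[r --> 0^'] --> within (@unit_ball R d) (nbhs x).
  move=> A /= /c0; apply: filter_app; near=> r; rewrite /= => h1; apply: h1.
  by rewrite /unit_ball/= norm2_le1 ltW//; near: r.
have ec : e (path r) @[r --> 0^'] --> (0 : R) by apply: cvg_comp cw e0.
have ech : e (path r) * norm2 h @[r --> 0^'] --> (0 : R).
  by rewrite -[X in _ --> X](mul0r (norm2 h)); apply: cvgM; [exact: ec|exact: cvg_cst].
have q : r^-1 *: (f (b + (r * 1 + s) *: h) - f x) @[r --> 0^'] --> dotv (g x) h.
  apply/cvgrPdist_le => eps eps0; near=> r.
  have r0 : r != 0 by near: r; exact: nbhs_dnbhs_neq.
  have pE : b + (r * 1 + s) *: h = path r.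
    by rewrite mulr1 scalerDl /path /x addrCA addrC.
  rewrite pE; have eE : f (path r) - f x = e (path r) * (`|r| * norm2 h) + r * dotv (g x) h.
    have -> : `|r| * norm2 h = norm2 (path r - x) by rewrite /path addrC addKr norm2Z.
    have -> : r * dotv (g x) h = dotv (g x) (path r - x).
      by rewrite /path addrC addKr dotvZr.
    (* For [h = 0] the quotient cannot be multiplied back, but both sides vanish. *)
    have [p0|p0] := eqVneq (path r - x) 0.
      by rewrite p0 (subr0_eq p0) subrr /norm2 !dotv0r sqrtr0 mulr0 addr0.
    by rewrite divfK ?gt_eqF ?norm2_gt0// subrK.
  rewrite eE /GRing.scale/= mulrDr mulKf// opprD addrCA subrr addr0 normrN.
  rewrite mulrCA normrM (normrM r^-1) normfV (normrM `|r|) normr_id mulKf ?normr_eq0//.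
  have : `|0 - e (path r) * norm2 h| <= eps by near: r; move/cvgrPdist_le: ech; exact.
  by rewrite sub0r normrN normrM.
apply: DeriveDef.
  by apply/cvg_ex; exists (dotv (g x) h).
exact/cvg_lim.
Unshelve. all: by end_near. Qed.

Lemma is_derive_unique (R : realType) (p : R -> R) (s q q' : R) :
  is_derive s 1 p q -> is_derive s 1 p q' -> q = q'.
Proof. by move=> [_ <-] [_ <-]. Qed.

Lemma is_derive_quotient (R : realType) (p : R -> R) (s q : R) :
  is_derive s 1 p q -> r^-1 * (p (r + s) - p s) @[r --> 0^'] --> q.
Proof.
move=> [dp <-]; rewrite /derive/=; under eq_fun do rewrite -[X in p (X + s)]mulr1.
exact: dp.
Qed.

Lemma is_derive_le (R : realType) (p : R -> R) (s q K : R) :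
    is_derive s 1 p q -> (\forall r \near 0^'+, p (r + s) - p s <= r * K) -> q <= K.
Proof.
move=> /is_derive_quotient/cvg_dnbhs_at_right/cvgr_to_le dp h; apply: dp.
near=> r; have r0 : 0 < r by near: r; exact: nbhs_right_gt.
by rewrite ler_pdivrMl//; near: r.
Unshelve. all: by end_near. Qed.

Lemma is_derive_min (R : realType) (p : R -> R) (s q : R) :
  is_derive s 1 p q -> (\forall r \near s, p s <= p r) -> q = 0.
Proof.
move=> dp pmin; have dq := is_derive_quotient dp.
have shift0 : \forall r \near (0 : R), p s <= p (r + s).
  have c : r + s @[r --> (0 : R)] --> s.
    by rewrite -[X in _ --> X]add0r; apply: cvgD; [exact: cvg_id|exact: cvg_cst].
  exact: c pmin.
apply/eqP; rewrite eq_le; apply/andP; split.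
  apply: (cvgr_to_le (cvg_dnbhs_at_left dq)); near=> r.
  have r0 : r < 0 by near: r; exact: nbhs_left_lt.
  rewrite nmulr_rle0 ?invr_lt0// subr_ge0.
  by near: r; apply: cvg_within; exact: shift0.
apply: (cvgr_to_ge (cvg_dnbhs_at_right dq)); near=> r.
have r0 : 0 < r by near: r; exact: nbhs_right_gt.
rewrite pmulr_rge0 ?invr_gt0// subr_ge0.
by near: r; apply: cvg_within; exact: shift0.
Unshelve. all: by end_near. Qed.

(** * Convexity on the ball *)

Lemma convex_line (R : realType) (d : nat) (f : 'rV[R]_d -> R) x y (s : R) :
    convex_function (@unit_ball R d) f -> unit_ball x -> unit_ball y -> 0 <= s <= 1 ->
  f (x + s *: (y - x)) - f x <= s * (f y - f x).
Proof.
move=> cf Bx By /andP[s0 s1].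
have xB : x \in (@unit_ball R d) by rewrite inE.
have yB : y \in (@unit_ball R d) by rewrite inE.
have h : f (s *: y + (1 - s) *: x) <= s * f y + (1 - s) * f x.
  exact: cf (Itv01 s0 s1) y x yB xB.
have -> : x + s *: (y - x) = s *: y + (1 - s) *: x.
  by rewrite scalerBr scalerBl scale1r addrCA.
lra.
Qed.

(** The chord from [x] to [y] bounds the right difference quotients at [x]. Only [x] has to be
    interior, so [y] may lie on the sphere. *)
Lemma gradient_ineq (R : realType) (d : nat) (f : 'rV[R]_d -> R) g x y :
    convex_function (@unit_ball R d) f -> has_gradient (@unit_ball R d) f g ->
    dotv x x < 1 -> unit_ball y ->
  dotv (g x) (y - x) <= f y - f x.
Proof.
move=> cf fg x1 By.
have Bx : unit_ball x by rewrite /unit_ball/= norm2_le1 ltW.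
have x0 : x + 0 *: (y - x) = x by rewrite scale0r addr0.
have := @is_derive_line R d f g x (y - x) 0 fg; rewrite x0 => /(_ x1) /is_derive_le; apply.
near=> r; rewrite addr0 x0; apply: convex_line => //.
by apply/andP; split; near: r; [exact: nbhs_right_ge|apply: nbhs_right_le].
Unshelve. all: by end_near. Qed.

(** * Self-concordance restricted to a segment *)

(** Convexity and self-concordance in one variable, with the power 3/2 as [u * sqrt u]. Derivatives
    are two-sided even at 0 and 1, which suits segments in the open ball. *)
Definition concordant_on_segment (R : realType) (C : R) (p0 : R -> R) : Prop :=
  exists p1 p2 p3 : R -> R, forall s : R, 0 <= s <= 1 ->
    [/\ is_derive s 1 p0 (p1 s), is_derive s 1 p1 (p2 s), is_derive s 1 p2 (p3 s),
        0 <= p2 s & `|p3 s| <= 2 * C * (p2 s * Num.sqrt (p2 s))].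

(** The constant does not grow with the number of summands because [u * sqrt u] is superadditive on
    nonnegative numbers. *)
Lemma concordant_on_segment_sum (R : realType) (I : eqType) (r : seq I) (C : R)
    (p : I -> R -> R) :
    0 <= C -> (forall i, i \in r -> concordant_on_segment C (p i)) ->
  concordant_on_segment C (fun s => \sum_(i <- r) p i s).
Proof.
move=> C0; elim: r => [_|i r IHr pr].
  under eq_fun do rewrite big_nil.
  exists (cst 0), (cst 0), (cst 0) => s _.
  by split; rewrite /cst ?normr0 ?mul0r ?mulr0//; exact: is_derive_cst.
under eq_fun do rewrite big_cons.
have [p1 [p2 [p3 pE]]] := pr i (mem_head i r).
have [|q1 [q2 [q3 qE]]] := IHr; first by move=> j jr; apply: pr; rewrite in_cons jr orbT.
exists (p1 + q1), (p2 + q2), (p3 + q3) => s s01.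
have [dp0 dp1 dp2 p20 p3C] := pE s s01; have [dq0 dq1 dq2 q20 q3C] := qE s s01.
split; [exact: is_deriveD|exact: is_deriveD|exact: is_deriveD|exact: addr_ge0|].
rewrite !fctE; apply: le_trans (ler_normD _ _) _; apply: le_trans (lerD p3C q3C) _.
rewrite -mulrDr ler_wpM2l ?mulr_ge0// mulrDl lerD// ler_wpM2l// ler_sqrt ?addr_ge0//.
  by rewrite lerDl.
by rewrite lerDr.
Qed.

(** Adding the gradient inequalities between [x] and [x + r *: h] in both directions shows that the
    slope along [h] increases. *)
Lemma quad_form_ge0 (R : realType) (d : nat) (f : 'rV[R]_d -> R) g H (x h : 'rV[R]_d) :
    convex_function (@unit_ball R d) f -> has_gradient (@unit_ball R d) f g ->
    dotv x x < 1 ->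
    is_derive (0 : R) 1 (fun r : R => dotv (g (x + r *: h)) h) (quad_form H h) ->
  0 <= quad_form H h.
Proof.
move=> cf fg x1 dq; rewrite -oppr_le0.
apply: (is_derive_le (is_deriveN dq)); rewrite fctE.
have x0 : x + 0 *: h = x by rewrite scale0r addr0.
have := @open_unit_ball_line R d x h 0; rewrite x0 => /(_ x1) near1.
near=> r; rewrite addr0 mulr0.
have r0 : 0 < r by near: r; exact: nbhs_right_gt.
have r1 : dotv (x + r *: h) (x + r *: h) < 1.
  by near: r; apply: cvg_within; exact: near1.
have B (y : 'rV[R]_d) : dotv y y < 1 -> unit_ball y by rewrite /unit_ball/= norm2_le1; exact: ltW.
have := gradient_ineq cf fg r1 (B _ x1); have := gradient_ineq cf fg x1 (B _ r1).
rewrite opprD addrA subrr sub0r (addrC x) addrK dotvNr !dotvZr => le1 le2.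
by rewrite -(pmulr_rle0 _ r0); lra.
Unshelve. all: by end_near. Qed.

Lemma concordant_line (R : realType) (d : nat) (C : R) (f : 'rV[R]_d -> R) b h :
    convex_function (@unit_ball R d) f -> self_concordant (@unit_ball R d) C f ->
    (forall s : R, 0 <= s <= 1 -> dotv (b + s *: h) (b + s *: h) < 1) ->
  concordant_on_segment C (fun s => f (b + s *: h)).
Proof.
move=> cf [g [H [D [fg gH HD DC]]]] lt1.
pose y (s : R) := b + s *: h.
(* The base point is arbitrary: the claim serves at [b] with parameter [s], and at [y s] with
   parameter 0 for the sign of the quadratic form. *)
have dg z e (s : R) : dotv (z + s *: e) (z + s *: e) < 1 ->
    is_derive s 1 (fun s : R => dotv (g (z + s *: e)) e) (quad_form (H (z + s *: e)) e).
  move=> zs; apply: is_derive_eq.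
    apply: (is_derive_bigsum (F := fun i (s : R) => g (z + s *: e) 0 i * e 0 i)) => i _.
    apply: (@is_deriveM _ _ (fun s : R => g (z + s *: e) 0 i) (cst (e 0 i))).
    exact: (is_derive_line (gH i)).
  rewrite /quad_form; apply: eq_bigr => i _.
  rewrite scaler0 add0r /GRing.scale/= /dotv mulr_sumr; apply: eq_bigr => j _.
  by rewrite mxE mulrC mulrAC.
exists (fun s => dotv (g (y s)) h), (fun s => quad_form (H (y s)) h),
  (fun s => cubic_form (D (y s)) h) => s s01.
have ys := lt1 s s01; have q0 : 0 <= quad_form (H (y s)) h.
  apply: (quad_form_ge0 (H := H (y s)) cf fg ys).
  by have := dg (y s) h 0; rewrite scale0r addr0; apply.
split=> //.
- exact: is_derive_line.
- exact: dg.
- apply: is_derive_eq.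
    apply: (is_derive_bigsum (F := fun i (s : R) => \sum_j H (y s) i j * h 0 i * h 0 j)) => i _.
    apply: (is_derive_bigsum (F := fun j (s : R) => H (y s) i j * h 0 i * h 0 j)) => j _.
    apply: (@is_deriveM _ _ _ (cst (h 0 j))).
    apply: (@is_deriveM _ _ (fun s : R => H (y s) i j) (cst (h 0 i))).
    exact: (is_derive_line (HD i j)).
  rewrite /cubic_form; apply: eq_bigr => i _; apply: eq_bigr => j _.
  rewrite !scaler0 !add0r /GRing.scale/= /dotv !mulr_sumr; apply: eq_bigr => k _.
  by rewrite mxE; ring.
- apply: le_trans (DC _ _ _) _; first by rewrite /unit_ball/= norm2_le1 ltW.
  rewrite (_ : 3 / 2 = 1 + 2^-1); last by field.
  (* The exponent [1 + 2^-1] splits only over a nonzero base; at base 0 both sides are 0. *)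
  have [->|qn0] := eqVneq (quad_form (H (y s)) h) 0.
    rewrite powR0 ?mul0r//; lra.
  by rewrite powRD ?qn0 ?implybT// powRr1// powR12_sqrt.
Qed.

(** * The logarithmic barrier along a line *)

(** Here [rho], [k + rho ^+ 2] and [3 * k * rho + 2 * rho ^+ 3] are the first three derivatives of
    the barrier along a line, [k] being [2|h|^2] over the slack. After squaring, the two sides
    differ by [k ^+ 2 * (4 * k + 3 * rho ^+ 2)]. *)
Lemma barrier_concordant (R : realType) (k rho : R) :
  0 <= k -> `|3 * k * rho + 2 * rho ^+ 3| <=
    2 * ((k + rho ^+ 2) * Num.sqrt (k + rho ^+ 2)).
Proof.
move=> k0; have rho2 := sqr_ge0 rho.
have q0 : 0 <= k + rho ^+ 2 by rewrite addr_ge0.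
rewrite -ler_sqr ?nnegrE ?normr_ge0 ?mulr_ge0 ?sqrtr_ge0// real_normK ?num_real//.
rewrite !exprMn sqr_sqrtr// -subr_ge0.
rewrite (_ : _ - _ = k ^+ 2 * (4 * k + 3 * rho ^+ 2)); last by ring.
by rewrite mulr_ge0 ?exprn_ge0// addr_ge0// mulr_ge0.
Qed.

Lemma is_derive_mul (R : realType) (f g : R -> R) (df dg s : R) :
    is_derive s 1 f df -> is_derive s 1 g dg ->
  is_derive s 1 (fun x => f x * g x) (df * g s + f s * dg).
Proof.
move=> hf hg; apply: is_derive_eq (is_deriveM hf hg) _.
by rewrite /GRing.scale/= addrC (mulrC df).
Qed.

(** The finite branch of [log_barrier], meaningful on the open ball only; all iterates will be shown
    to lie there. *)
Definition log_slack (R : realType) (d : nat) (y : 'rV[R]_d) : R := - ln (1 - dotv y y).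

Lemma log_slack_line (R : realType) (d : nat) (b h : 'rV[R]_d) :
  exists q1 q2 q3 : R -> R, forall s : R, dotv (b + s *: h) (b + s *: h) < 1 ->
    [/\ is_derive s 1 (fun r : R => log_slack (b + r *: h)) (q1 s),
        is_derive s 1 q1 (q2 s), is_derive s 1 q2 (q3 s),
        2 * norm2 h ^+ 2 <= q2 s & `|q3 s| <= 2 * (q2 s * Num.sqrt (q2 s))].
Proof.
pose N := dotv h h; pose w (s : R) := 1 - dotv (b + s *: h) (b + s *: h).
pose m (s : R) := 2 * dotv b h + 2 * N * s.
have did (s : R) : is_derive s 1 (fun x : R => x) 1 := is_derive_id s 1.
have dw (s : R) : is_derive s 1 w (- m s).
  have -> : w = (fun s => (1 - dotv b b) + (- 2 * dotv b h) * s + (- N) * (s * s)).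
    by apply/funext => x; rewrite /w dotv_line -/N; ring.
  have := is_deriveD (is_deriveD (is_derive_cst (1 - dotv b b : R) s 1)
    (is_deriveZ (- 2 * dotv b h) (did s))) (is_deriveZ (- N) (is_derive_mul (did s) (did s))).
  by move=> /is_derive_eq; apply; rewrite /m /GRing.scale/=; ring.
have dm (s : R) : is_derive s 1 m (2 * N).
  have := is_deriveD (is_derive_cst (2 * dotv b h : R) s 1) (is_deriveZ (2 * N) (did s)).
  by move=> /is_derive_eq; apply; rewrite /GRing.scale/=; ring.
pose iw (s : R) := (w s)^-1.
have diw (s : R) : w s != 0 -> is_derive s 1 iw (m s * iw s ^+ 2).
  move=> w0; have := is_deriveV w0 (dw s) => /is_derive_eq; apply.
  by rewrite /GRing.scale/= /iw exprVn; ring.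
pose q1 (s : R) := m s * iw s; pose q2 (s : R) := 2 * N * iw s + q1 s * q1 s.
pose q3 (s : R) := 3 * (2 * N * iw s) * q1 s + 2 * q1 s ^+ 3.
exists q1, q2, q3 => s lt1; have w0 : 0 < w s by rewrite subr_gt0.
have dwi := diw s (lt0r_neq0 w0).
have dq1 : is_derive s 1 q1 (q2 s).
  have := is_derive_mul (dm s) dwi => /is_derive_eq; apply.
  by rewrite /q2 /q1; ring.
(* The slack is at most 1; this is the source of the strong convexity bound [2 * norm2 h ^+ 2]. *)
have iw1 : 1 <= iw s by rewrite invf_ge1// gerBl dotvv_ge0.
have N0 : 0 <= N := dotvv_ge0 h.
split.
- have := is_deriveN (is_derive1_comp (is_derive1_ln w0) (dw s)) => /is_derive_eq; apply.
  by rewrite /q1 /GRing.scale/= mulrN opprK mulrC.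
- exact: dq1.
- have := is_deriveD (is_deriveZ (2 * N) dwi) (is_derive_mul dq1 dq1).
  by move=> /is_derive_eq; apply; rewrite /GRing.scale/= /q3 /q2 /q1; ring.
- rewrite /q2 -expr2 sqr_norm2 -/N -[leLHS]addr0 lerD ?sqr_ge0//.
  by rewrite -[leLHS]mulr1 ler_wpM2l// mulr_ge0.
- rewrite /q2 -expr2; apply: barrier_concordant; rewrite !mulr_ge0//.
  exact: le_trans iw1.
Qed.

(** * One round of the algorithm *)

(** Here [a] and [b] are the minimisers before and after the loss [f] is added. Both are interior,
    so first-order optimality along [a - b] provides the end slopes asked for by [segment_bound]. *)
Lemma round_bound (R : realType) (d : nat) (L beta C eta : R)
    (P f : 'rV[R]_d -> R) (a b : 'rV[R]_d) :
    0 < L -> 0 < beta -> 0 <= C -> 0 < eta ->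
    concordant_on_segment C (fun s => P (b + s *: (a - b))) ->
    convex_function (@unit_ball R d) f -> lipschitz_grad (@unit_ball R d) L f ->
    smooth (@unit_ball R d) beta f ->
    dotv a a < 1 -> dotv b b < 1 ->
    (forall y, dotv y y < 1 ->
       P a + eta^-1 * log_slack a <= P y + eta^-1 * log_slack y) ->
    (forall y, dotv y y < 1 ->
       P b + eta^-1 * log_slack b + f b <= P y + eta^-1 * log_slack y + f y) ->
  2 * ((P a + eta^-1 * log_slack a) - (P b + eta^-1 * log_slack b)) + (f a - f b) <=
  16 * (C * L ^+ 3 * (eta * Num.sqrt eta) + (L ^+ 3 + beta * L ^+ 2) * eta ^+ 2).
Proof.
move=> L0 beta0 C0 eta0 [p1 [p2 [p3 pE]]] cf [g fg gL] [g' fg' g'beta] a1 b1 amin bmin.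
have [ab|ab] := eqVneq (a - b) 0.
  rewrite (subr0_eq ab) !subrr mulr0 addr0.
  by rewrite !(mulr_ge0, addr_ge0, sqrtr_ge0, exprn_ge0)// ltW.
set h := a - b in pE ab *; set Phi := fun y => P y + eta^-1 * log_slack y.
have N0 := norm2_gt0 ab.
have bh1 : b + 1 *: h = a by rewrite scale1r addrC subrK.
have bh0 : b + 0 *: h = b by rewrite scale0r addr0.
have in1 (s : R) : 0 <= s <= 1 -> dotv (b + s *: h) (b + s *: h) < 1.
  move=> /andP[s0]; rewrite le_eqVlt => /predU1P[->|s1]; first by rewrite bh1.
  by apply: (line_lt1 b1 (ltW a1)); rewrite s0.
have B y : dotv y y < 1 -> @unit_ball R d y by rewrite /unit_ball/= norm2_le1; exact: ltW.
have [q1 [q2 [q3 qE]]] := log_slack_line b h.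
have dPhi (s : R) : 0 <= s <= 1 ->
    is_derive s 1 (fun r : R => Phi (b + r *: h)) (p1 s + eta^-1 * q1 s).
  move=> s01; have [dp _ _ _ _] := pE s s01; have [dq _ _ _ _] := qE s (in1 s s01).
  exact: (is_deriveD dp (is_deriveZ eta^-1 dq)).
have z01 : (0 : R) <= 0 <= (1 : R) by rewrite lexx ler01.
have o01 : (0 : R) <= 1 <= (1 : R) by rewrite lexx ler01.
(* The Lipschitz and smoothness hypotheses each bring their own gradient; both give the same
   directional derivative at [b], so they can be exchanged there. *)
have df : is_derive (0 : R) 1 (fun r : R => f (b + r *: h)) (dotv (g b) h).
  by have := is_derive_line fg (in1 0 z01); rewrite bh0.
have df' : is_derive (0 : R) 1 (fun r : R => f (b + r *: h)) (dotv (g' b) h).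
  by have := is_derive_line fg' (in1 0 z01); rewrite bh0.
have opt1 : p1 1 + eta^-1 * q1 1 = 0.
  apply: (is_derive_min (dPhi 1 o01)); rewrite bh1.
  by apply: filterS (open_unit_ball_line (in1 1 o01)) => r; exact: amin.
have opt0 : p1 0 + eta^-1 * q1 0 = - dotv (g b) h.
  apply/eqP; rewrite -addr_eq0; apply/eqP.
  apply: (is_derive_min (is_deriveD (dPhi 0 z01) df)); rewrite !fctE bh0.
  by apply: filterS (open_unit_ball_line (in1 0 z01)) => r; exact: bmin.
have gradL x y : dotv x x < 1 -> dotv (g x) y <= L * norm2 y.
  move=> x1; apply: le_trans (dotv_le_norm2 _ _) _.
  by rewrite ler_wpM2r ?norm2_ge0// gL//; exact: B.
rewrite -/(Phi a) -/(Phi b) -bh1 -{2 4}bh0.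
apply: (@segment_bound R (fun s => P (b + s *: h)) p1 p2 p3
   (fun s => log_slack (b + s *: h)) q1 q2 q3 _ _ (dotv (g b) h) eta L C beta (norm2 h)) => //.
- by move=> s s01; have [] := pE s s01.
- by move=> s s01; have [] := pE s s01.
- by move=> s s01; have [] := pE s s01.
- by move=> s s01; have [] := qE s (in1 s s01).
- by move=> s s01; have [] := qE s (in1 s s01).
- by move=> s s01; have [] := qE s (in1 s s01).
- by move=> s s01; have [] := pE s s01.
- by move=> s s01; have [] := qE s (in1 s s01).
- by rewrite bh1 bh0; exact: amin.
- exact: gradL.
- rewrite bh1 bh0; have := gradient_ineq cf fg a1 (B _ b1).
  have := gradL a h a1; rewrite -(opprB a b) -/h dotvNr; lra.
- rewrite bh1 bh0 (is_derive_unique df df'); exact: g'beta (B _ a1) (B _ b1).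
Qed.

(** * Real powers, the step size and the rate *)

Lemma powR_frac (R : realType) (a : R) (m n : nat) :
  a `^ (m%:R / n%:R) = (a `^ (n%:R^-1)) ^+ m.
Proof. by rewrite mulrC powRrM powR_mulrn// powR_ge0. Qed.

Lemma powR_root (R : realType) (a : R) (n : nat) :
  0 <= a -> (0 < n)%N -> (a `^ (n%:R^-1)) ^+ n = a.
Proof.
by move=> a0 n0; rewrite -powR_frac divff ?powRr1// pnatr_eq0 -lt0n.
Qed.

(** Each candidate step balances [eta^-1 * ln T] against one error term, both then being equal to
    one term of the rate; the errors increase with [eta], so the minimum is safe. Cube and fifth
    roots turn these equalities into rational identities. The bound on [L] will pay for shrinking
    the comparator. *)
Lemma step_size_bounds (R : realType) (T : nat) (L beta C : R) :
    (2 <= T)%N -> 0 < L -> 0 < beta -> 0 <= C ->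
    let eta := step_size T L beta C in let rate := regret_rate T L beta C in
  [/\ 0 < eta, eta^-1 * ln T%:R <= rate,
      T%:R * (C * L ^+ 3 * (eta * Num.sqrt eta)) <= rate,
      T%:R * ((L ^+ 3 + beta * L ^+ 2) * eta ^+ 2) <= rate & L <= 2 * rate].
Proof.
move=> T2 L0 beta0 C0 eta rate.
have T1 : (1 : R) <= T%:R by rewrite ler1n ltnW.
have T0 : (0 : R) < T%:R by rewrite (lt_le_trans ltr01).
have [T_ge0 L_ge0 beta_ge0] : [/\ 0 <= T%:R :> R, 0 <= L & 0 <= beta] by rewrite !ltW.
(* From [ln (1 + x) <= x] at [x = T^-1 - 1], which is at most [- 1 / 2]. *)
have lnT : 1 / 2 <= ln (T%:R : R).
  have V1 : T%:R^-1 <= 1 / 2 :> R.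
    by rewrite div1r lef_pV2 ?posrE// ler_nat.
  have : ln (1 + (T%:R^-1 - 1)) <= T%:R^-1 - 1 :> R.
    have V0 : 0 < T%:R^-1 :> R by rewrite invr_gt0.
    by apply: le_ln1Dx; lra.
  by rewrite addrC subrK lnV ?posrE//; lra.
have lnT0 : 0 < ln (T%:R : R) by lra.
pose A := L ^+ 3 + beta * L ^+ 2.
have A0 : 0 < A by rewrite addr_gt0 ?mulr_gt0 ?exprn_gt0.
pose al := ln (T%:R : R) `^ 3^-1; pose ga := A `^ 3^-1; pose ta := (T%:R : R) `^ 3^-1.
have al0 : 0 < al by rewrite powR_gt0.
have ga0 : 0 < ga by rewrite powR_gt0.
have ta0 : 0 < ta by rewrite powR_gt0.
have alE : al ^+ 3 = ln (T%:R : R) by rewrite powR_root// ltW.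
have gaE : ga ^+ 3 = A by rewrite powR_root// ltW.
have taE : ta ^+ 3 = T%:R by rewrite powR_root// ltW.
pose eta2 := al / (ga * ta).
have eta20 : 0 < eta2 by rewrite divr_gt0// mulr_gt0.
have eta2E : ln T%:R `^ (1 / 3) * A `^ (- (1 / 3)) * T%:R `^ (- (1 / 3)) = eta2.
  by rewrite !powRN !(powR_frac _ 1) !expr1 /eta2 invfM mulrA.
pose rate2 := al ^+ 2 * ga * ta.
have rate2E : ln T%:R `^ (2 / 3) * A `^ (1 / 3) * T%:R `^ (1 / 3) = rate2.
  by rewrite !(powR_frac _ 1) (powR_frac _ 2) !expr1.
have lnT2 : eta2^-1 * ln T%:R = rate2.
  by rewrite -alE /eta2 /rate2; field; rewrite !lt0r_neq0.
pose B := C * L ^+ 3.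
have B0 : 0 <= B by rewrite mulr_ge0// exprn_ge0// ltW.
pose al' := ln (T%:R : R) `^ 5^-1; pose ga' := B `^ 5^-1; pose ta' := (T%:R : R) `^ 5^-1.
have al'0 : 0 < al' by rewrite powR_gt0.
have ta'0 : 0 < ta' by rewrite powR_gt0.
have al'E : al' ^+ 5 = ln (T%:R : R) by rewrite powR_root// ltW.
have ga'E : ga' ^+ 5 = B by rewrite powR_root.
have ta'E : ta' ^+ 5 = T%:R by rewrite powR_root// ltW.
(* As a square, [eta1] has an explicit square root. For [C = 0] it is 0 by the convention on
   division, hence the guards [C != 0] below. *)
pose eta1 := (al' / (ga' * ta')) ^+ 2.
have eta1E : ln T%:R `^ (2 / 5) * B `^ (- (2 / 5)) * T%:R `^ (- (2 / 5)) = eta1.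
  by rewrite !powRN !(powR_frac _ 2) /eta1 exprMn exprVn exprMn (invfM (ga' ^+ 2)) mulrA.
pose rate1 := al' ^+ 3 * ga' ^+ 2 * ta' ^+ 2.
have rate1E : ln T%:R `^ (3 / 5) * B `^ (2 / 5) * T%:R `^ (2 / 5) = rate1.
  by rewrite (powR_frac _ 3) !(powR_frac _ 2).
have etaE : eta = if C == 0 then eta2 else Num.min eta1 eta2.
  by rewrite /eta /step_size eta1E eta2E.
have rateE : rate = Num.max rate1 rate2 by rewrite /rate /regret_rate rate1E rate2E.
have r1 : rate1 <= rate by rewrite rateE le_max lexx.
have r2 : rate2 <= rate by rewrite rateE le_max lexx orbT.
have ga'0 : C != 0 -> 0 < ga'.
  move=> Cn; rewrite powR_gt0// mulr_gt0 ?exprn_gt0//.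
  by rewrite lt_neqAle eq_sym Cn.
have eta10 : C != 0 -> 0 < eta1.
  by move=> /ga'0 h; rewrite exprn_gt0// divr_gt0// mulr_gt0.
have eta0 : 0 < eta.
  by rewrite etaE; case: eqP => // /eqP /eta10 h; rewrite lt_min h.
have le2 : eta <= eta2 by rewrite etaE; case: ifP => // _; rewrite ge_min lexx orbT.
have le1 : C != 0 -> eta <= eta1.
  by rewrite etaE => /negbTE ->; rewrite ge_min lexx.
have eta_ge0 := ltW eta0; have A_ge0 := ltW A0.
split=> //.
- rewrite etaE; case: eqP => [_|/eqP C1]; first by rewrite lnT2.
  case: (leP eta1 eta2) => _; last by rewrite lnT2.
  rewrite (_ : eta1^-1 * _ = rate1)// -al'E /eta1 /rate1; field.
  by rewrite !lt0r_neq0// ga'0.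
- have [->|C1] := eqVneq C 0.
    rewrite !mul0r mulr0 (le_trans _ r2)//.
    by rewrite !mulr_ge0 ?exprn_ge0// ltW.
  apply: le_trans r1; have g0 := ga'0 C1.
  rewrite (_ : rate1 = T%:R * (C * L ^+ 3 * (eta1 * Num.sqrt eta1))).
    have e1 := le1 C1; rewrite ler_wpM2l// ler_wpM2l// ler_pM ?sqrtr_ge0//.
    by rewrite ler_sqrt// ltW// eta10.
  rewrite -/B -ga'E -ta'E /eta1 sqrtr_sqr ger0_norm.
    by rewrite /rate1; field; rewrite !lt0r_neq0.
  by rewrite ltW// divr_gt0// mulr_gt0.
- apply: le_trans r2; rewrite (_ : rate2 = T%:R * (A * eta2 ^+ 2)).
    by rewrite ler_wpM2l// ler_wpM2l// ler_pXn2r// nnegrE// ltW.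
  by rewrite -gaE -taE /rate2 /eta2; field; rewrite !lt0r_neq0.
- apply: le_trans (_ : 2 * rate2 <= _); last by rewrite ler_wpM2l.
  have ta1 : 1 <= ta by rewrite -(@ler_pXn2r _ 3)// ?nnegrE ?(ltW ta0)// expr1n taE.
  have gaL : L <= ga.
    by rewrite -(@ler_pXn2r _ 3)// ?nnegrE ?(ltW ga0)// gaE lerDl mulr_ge0 ?exprn_ge0.
  (* If [al < 1] then [al ^+ 2] is at least [al ^+ 3 = ln T]. *)
  have al2 : 1 / 2 <= al ^+ 2.
    have [a1|a1] := leP 1 al; first by rewrite (le_trans _ (exprn_ege1 2 a1))//; lra.
    rewrite -alE in lnT; apply: le_trans lnT _; rewrite exprS.
    by rewrite ger_pMl ?exprn_gt0// ltW.
  rewrite /rate2; have h1 : 1 / 2 * L <= al ^+ 2 * ga by apply: ler_pM => //; lra.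
  have : 1 / 2 * L * 1 <= al ^+ 2 * ga * ta by apply: ler_pM => //; lra.
  lra.
Qed.

(** * Regret against an interior comparator *)

Lemma sum_losses_recr (R : realType) (d : nat) (f : nat -> 'rV[R]_d -> R) (t : nat) y :
  (1 <= t)%N -> \sum_(1 <= s < t.+1) f s y = \sum_(1 <= s < t) f s y + f t y.
Proof. by move=> t1; rewrite big_nat_recr. Qed.

Lemma ftrl_objective_interior (R : realType) (d : nat) (f : nat -> 'rV[R]_d -> R)
    (eta : R) (t : nat) (y : 'rV[R]_d) :
    dotv y y < 1 ->
  ftrl_objective f eta t y =
    (\sum_(1 <= s < t) f s y + eta^-1 * log_slack y)%:E.
Proof.
by move=> y1; rewrite /ftrl_objective /log_barrier norm2_lt1 y1 sqr_norm2.
Qed.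

(** On the sphere the objective is infinite, whereas at the origin it is finite. *)
Lemma argmin_interior (R : realType) (d : nat) (f : nat -> 'rV[R]_d -> R)
    (eta : R) (t : nat) (x : 'rV[R]_d) :
    0 < eta -> argmin (@unit_ball R d) (ftrl_objective f eta t) x ->
  dotv x x < 1.
Proof.
move=> eta0 [Bx /(_ 0)]; have lt1 : dotv (0 : 'rV[R]_d) 0 < 1 by rewrite dotv0r.
rewrite /unit_ball/= norm2_le1 ltW// => /(_ isT).
rewrite (ftrl_objective_interior _ _ _ lt1) /ftrl_objective /log_barrier norm2_lt1.
by case: ltP => // _; rewrite gt0_muley ?lte_fin ?invr_gt0// addey.
Qed.

Lemma log_slack_ge0 (R : realType) (d : nat) (y : 'rV[R]_d) : 0 <= log_slack y.
Proof. by rewrite oppr_ge0 ln_le0// gerBl dotvv_ge0. Qed.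

Lemma ftrl_regret (R : realType) (d T : nat) (L beta C eta : R)
    (f : nat -> 'rV[R]_d -> R) (x : nat -> 'rV[R]_d) (u : 'rV[R]_d) :
    0 < L -> 0 < beta -> 0 <= C -> 0 < eta ->
    (forall t, (1 <= t <= T)%N ->
       [/\ convex_function (@unit_ball R d) (f t),
           lipschitz_grad (@unit_ball R d) L (f t),
           smooth (@unit_ball R d) beta (f t) &
           self_concordant (@unit_ball R d) C (f t)]) ->
    (forall t, (1 <= t <= T.+1)%N ->
       argmin (@unit_ball R d) (ftrl_objective f eta t) (x t)) ->
    dotv u u < 1 ->
  \sum_(1 <= t < T.+1) (f t (x t) + f t (x t.+1)) - 2 * \sum_(1 <= t < T.+1) f t u <=
  2 * (eta^-1 * log_slack u) + 16 * (T%:R *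
    (C * L ^+ 3 * (eta * Num.sqrt eta) + (L ^+ 3 + beta * L ^+ 2) * eta ^+ 2)).
Proof.
move=> L0 beta0 C0 eta0 fP xmin u1; set Q := (X in T%:R * X).
pose Phi t y := \sum_(1 <= s < t) f s y + eta^-1 * log_slack y.
have x1 t : (1 <= t <= T.+1)%N -> dotv (x t) (x t) < 1.
  by move=> /xmin /argmin_interior; apply.
have opt t y : (1 <= t <= T.+1)%N -> dotv y y < 1 -> Phi t (x t) <= Phi t y.
  move=> tT y1; have [_ /(_ y)] := xmin t tT.
  rewrite !ftrl_objective_interior ?x1// lee_fin; apply.
  by rewrite /unit_ball/= norm2_le1 ltW.
have PhiS t y : (1 <= t)%N -> Phi t.+1 y = Phi t y + f t y.
  by move=> t1; rewrite /Phi sum_losses_recr// addrAC.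
(* Once [PhiS] unfolds [Phi t.+1], this is a rearrangement of the bound [D_t <= 16 * Q]. *)
have step t : (1 <= t < T.+1)%N ->
    f t (x t) + f t (x t.+1) <= 16 * Q + 2 * (Phi t.+1 (x t.+1) - Phi t (x t)).
  move=> /andP[t1 tT]; rewrite PhiS//.
  have tT1 : (1 <= t <= T.+1)%N by rewrite t1 ltnW.
  have tT2 : (1 <= t.+1 <= T.+1)%N by [].
  have [cf lf sf _] := fP t (introT andP (conj t1 tT)).
  suff : 2 * (Phi t (x t) - Phi t (x t.+1)) + (f t (x t) - f t (x t.+1)) <= 16 * Q by lra.
  apply: (round_bound (P := fun y => \sum_(1 <= s < t) f s y)) => //.
  - apply: concordant_on_segment_sum => // s; rewrite mem_index_iota => /andP[s1 st].
    have sT : (1 <= s <= T)%N by rewrite s1 (leq_trans (ltnW st)).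
    have [cfs _ _ sfs] := fP s sT.
    apply: concordant_line => // r /andP[r0]; rewrite le_eqVlt => /predU1P[->|r1].
      by rewrite scale1r addrC subrK x1.
    by apply: (line_lt1 (x1 _ tT2) (ltW (x1 _ tT1))); rewrite r0.
  - exact: x1.
  - exact: x1.
  - by move=> y; exact: opt.
  - by move=> y y1; rewrite -!PhiS//; exact: opt.
have total : \sum_(1 <= t < T.+1) (f t (x t) + f t (x t.+1)) <=
    16 * (T%:R * Q) + 2 * (Phi T.+1 (x T.+1) - Phi 1%N (x 1%N)).
  rewrite -(telescope_sumr (fun t => Phi t (x t)))// mulr_sumr.
  have -> : 16 * (T%:R * Q) = \sum_(1 <= t < T.+1) 16 * Q.
    by rewrite sumr_const_nat subSS subn0 -mulr_natl; ring.
  rewrite -big_split/= big_nat_cond [leRHS]big_nat_cond.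
  by apply: ler_sum => t /andP[/step].
(* The comparator enters only here, through the optimality of the last iterate [x T.+1]; twice
   [Phi T.+1 u] holds both its losses and its barrier cost. *)
have : Phi T.+1 (x T.+1) <= Phi T.+1 u by apply: opt; rewrite ?ltnS ?leqnn.
have : 0 <= Phi 1%N (x 1%N).
  by rewrite /Phi big_geq// add0r mulr_ge0 ?log_slack_ge0// invr_ge0 ltW.
rewrite [Phi T.+1 u]/Phi; lra.
Qed.

(** * Shrinking the comparator, and the final bound *)

(** By convexity the cost is at most [r * (f 0 - f u)]. The gradient inequality at the origin, an
    interior point, bounds [f 0 - f u] by [L] even for [u] on the sphere. *)
Lemma shrink_cost (R : realType) (d : nat) (L r : R) (f : 'rV[R]_d -> R) u :
    0 < L -> convex_function (@unit_ball R d) f -> lipschitz_grad (@unit_ball R d) L f ->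
    unit_ball u -> 0 <= r <= 1 ->
  f ((1 - r) *: u) - f u <= r * L.
Proof.
move=> L0 cf [g fg gL] Bu r01.
have lt1 : dotv (0 : 'rV[R]_d) 0 < 1 by rewrite dotv0r.
have B0 : @unit_ball R d 0 by rewrite /unit_ball/= norm2_le1 ltW.
have -> : (1 - r) *: u = u + r *: (0 - u) by rewrite sub0r scalerN scalerBl scale1r.
apply: le_trans (convex_line cf Bu B0 r01) _.
have /andP[r0 _] := r01; rewrite ler_wpM2l//.
have := gradient_ineq cf fg lt1 Bu; rewrite subr0.
have nN : norm2 (- u) = norm2 u by rewrite -scaleN1r norm2Z normrN1 mul1r.
have := dotv_le_norm2 (g 0) (- u); rewrite dotvNr nN.
have : norm2 (g 0) * norm2 u <= L * 1 by rewrite ler_pM ?norm2_ge0// gL.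
lra.
Qed.

Lemma shrink_slack (R : realType) (d : nat) (r : R) (u : 'rV[R]_d) :
    unit_ball u -> 0 <= r <= 1 ->
  r <= 1 - dotv ((1 - r) *: u) ((1 - r) *: u).
Proof.
rewrite /unit_ball/= norm2_le1 => u1 /andP[r0 r1].
have s0 : 0 <= 1 - r by rewrite subr_ge0.
have h1 : 0 <= (1 - r) * (1 - dotv u u) by rewrite mulr_ge0// subr_ge0.
have h2 : 0 <= (1 - r) * (r * dotv u u) by rewrite !mulr_ge0 ?dotvv_ge0.
by rewrite dotvZl dotvZr; lra.
Qed.

Theorem corollary15 (R : realType) :
  exists2 K : R, 0 < K &
  forall (d T : nat) (L beta C : R)
         (f : nat -> 'rV[R]_d -> R) (x : nat -> 'rV[R]_d),
    (2 <= T)%N -> 0 < L -> 0 < beta -> 0 <= C ->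
    (forall t, (1 <= t <= T)%N ->
       [/\ convex_function (@unit_ball R d) (f t),
           lipschitz_grad (@unit_ball R d) L (f t),
           smooth (@unit_ball R d) beta (f t) &
           self_concordant (@unit_ball R d) C (f t)]) ->
    (forall t, (1 <= t <= T.+1)%N ->
       argmin (@unit_ball R d) (ftrl_objective f (step_size T L beta C) t) (x t)) ->
    (alt_regret (@unit_ball R d) T f x <= (K * regret_rate T L beta C)%:E)%E.
Proof.
(* [38 = 2 + 16 + 16 + 4]: the barrier at the comparator, the two error terms, and
   [2 * L <= 4 * rate] for the shrinking. *)
exists 38 => // d T L beta C f x T2 L0 beta0 C0 fP xmin.
have /= [] := step_size_bounds T2 L0 beta0 C0.
set eta := step_size _ _ _ _; set rate := regret_rate _ _ _ _.
move=> eta0 rlog rC rL rL0.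
apply: ge_ereal_sup => _ [u Bu <-]; rewrite lee_fin.
have T0 : (0 : R) < T%:R by rewrite ltr0n ltnW.
(* With this factor the shrinking costs [r * L] per round, [L] in total, and the barrier at the
   comparator is at most [ln T]. *)
pose r : R := T%:R^-1.
have r0 : 0 < r by rewrite invr_gt0.
have r1 : r <= 1 by rewrite invf_le1// ler1n ltnW.
have r01 : 0 <= r <= 1 by rewrite (ltW r0).
have slack := shrink_slack Bu r01.
have u1 : dotv ((1 - r) *: u) ((1 - r) *: u) < 1 by lra.
have := ftrl_regret L0 beta0 C0 eta0 fP xmin u1; rewrite mulrDr.
have : eta^-1 * log_slack ((1 - r) *: u) <= eta^-1 * ln T%:R.
  rewrite ler_wpM2l ?invr_ge0 ?(ltW eta0)//.
  by rewrite lerNl -lnV ?posrE// ler_ln ?posrE// subr_gt0.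
have : \sum_(1 <= t < T.+1) f t ((1 - r) *: u) - \sum_(1 <= t < T.+1) f t u <= L.
  rewrite -sumrB (_ : L = \sum_(1 <= t < T.+1) (r * L)).
    rewrite big_nat_cond [leRHS]big_nat_cond; apply: ler_sum => t /andP[tT _].
    have [cf lf _ _] := fP t tT.
    exact: shrink_cost.
  by rewrite sumr_const_nat subSS subn0 -mulr_natl /r mulVKf// lt0r_neq0.
lra.
Qed.
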